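(* Let $G=(V,E)$ be a finite DAG with maxoid polytope $P_G$. The vertices of $P_G$ are in one-to-one correspondence with the generic maxoids of $G$: a vertex $v$ corresponds to the maxoid $\mathcal{M}_*(G,C)$ of the weight matrices $C$ in the interior of the normal cone $N_v$. The faces $F$ of $P_G$ of dimension at least $1$ correspond to non-generic maxoids, i.e. to the maxoids $\mathcal{M}_*(G,C)$ of the non-generic weight matrices $C$, with $C$ in the relative interior of the normal cone $N_F$.
   Context: Let $G=(V,E)$ be a finite DAG. $\mathbb{R}^E$ denotes the set of weight matrices supported on $G$: $V\times V$ matrices $C=(c_{ij})$ with $c_{ij}\in\mathbb{R}$ if $i\to j\in E$ and $c_{ij}=-\infty$ otherwise (identified with the Euclidean space indexed by $E$). For distinct $i,j\in V$, $P(i,j)$ is the set of directed paths from $i$ to $j$ in $G$, and the weight of a path $\pi$ is $\omega_C(\pi)=\sum_{e\in\pi}c_e$. A path in $P(i,j)$ is critical (for $(G,C)$) if its weight is maximal among all paths in $P(i,j)$. $C$ is generic if for all distinct $i,j$ with $P(i,j)\ne\emptyset$ there is exactly one critical path from $i$ to $j$. For $L\subseteq V$, the critical DAG $G^*_{C,L}$ is the DAG on $V$ with an edge $i\to j$ ($i\neq j$) if and only if $P(i,j)\neq\emptyset$ and no critical path from $i$ to $j$ in $(G,C)$ has an interior node in $L$. Distinct $i,j\in V\setminus L$ are $C^*$-connected given $L$ if $G^*_{C,L}$ contains, up to exchanging $i$ and $j$, a path of one of the forms (a) $i\to j$; (b) $i\leftarrow p\to j$; (c) $i\to \ell\leftarrow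 j$; (d) $i\leftarrow p\to\ell\leftarrow j$; (e) $i\leftarrow p\to\ell\leftarrow q\to j$, with $\ell\in L$ and $p,q\notin L$. Otherwise they are $C^*$-separated given $L$. For pairwise disjoint $I,J,L\subseteq V$, $I$ and $J$ are $C^*$-separated given $L$ if every $i\in I$ and $j\in J$ are $C^*$-separated given $L$. The maxoid $\mathcal{M}_*(G,C)$ is the set of all triples (CI statements) $[I\perp\!\!\!\perp J\mid L]$ with $I,J,L$ pairwise disjoint such that $I$ and $J$ are $C^*$-separated given $L$ in $(G,C)$. It is called a generic maxoid of $G$ if it arises from a generic $C$, and a non-generic maxoid if it arises from a non-generic $C$ (the same set of CI statements may be both). The path polynomial of a pair of distinct nodes $i,j$ with $|P(i,j)|\geq1$ is $f_{ij}=\sum_{\pi\in P(i,j)}\prod_{u\to v\in\pi}x_{uv}\in\mathbb{R}[x_{uv}:u\to v\in E]$. $\operatorname{Newt}(f)\subset\mathbb{R}^E$ is the convex hull of the exponent vectors of the terms of $f$. The maxoid polytope is the Minkowski sum $P_G=\sum_{|P(i,j)|\ge1}\operatorname{Newt}(f_{ij})$. The normal cone of a non-empty face $F$ of $P_G$ is $N_F=\{c\in\mathbb{R}^E:\langle c,x\rangle=\max_{y\in P_G}\langle c,y\rangle\text{ for all }x\in F\}$. *)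

(* Defs.v *)
From HB Require Import structures.
From mathcomp Require Import all_boot all_order all_algebra.
From mathcomp Require Import all_classical all_reals all_analysis.
(* The notations of [mpoly] clash with those of MathComp-Analysis. *)
From mathcomp Require Import(canonicals, coercions) mpoly.

Set Implicit Arguments.
Unset Strict Implicit.
Unset Printing Implicit Defensive.

Import Order.TTheory GRing.Theory Num.Theory.
Import numFieldNormedType.Exports.

Local Open Scope classical_set_scope.
Local Open Scope ring_scope.

Section Polyhedra.
Context {R : realType} {n : nat}.
Implicit Types (A F P : set 'rV[R]_n) (c x y v : 'rV[R]_n).

Definition inner c x : R := \sum_(k < n) c 0 k * x 0 k.

Definition convex_hull A : set 'rV[R]_n :=
  smallest (fun B : set 'rV[R]_n => convex_set B) A.

Definition affine_set A : Prop :=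
  forall x y (t : R), A x -> A y -> A (t *: x + (1 - t) *: y).

Definition affine_hull A : set 'rV[R]_n := smallest affine_set A.

Definition relative_interior A : set 'rV[R]_n :=
  [set x | A x /\ within (affine_hull A) (nbhs x) A].

Definition minkowski_sum (T : finType) (Q : pred T)
    (A : T -> set 'rV[R]_n) : set 'rV[R]_n :=
  [set x | exists2 y : T -> 'rV[R]_n,
     forall t, Q t -> A t (y t) & x = \sum_(t | Q t) y t].

Definition affinely_independent k (y : 'I_k.+1 -> 'rV[R]_n) : bool :=
  row_free (\matrix_(i < k) (y (lift ord0 i) - y ord0)).

(* The affine dimension: the largest k such that A contains k + 1 affinely
   independent points. The empty set gets the value 0, but only nonempty sets
   are considered below. *)
Definition dimension A : nat :=
  \max_(k < n.+1 | `[< exists y : 'I_k.+1 -> 'rV[R]_n,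
                      affinely_independent y /\ forall i, A (y i) >]) k.

Definition maximizers P c : set 'rV[R]_n :=
  [set x | P x /\ forall y, P y -> inner c y <= inner c x].

(* Nonempty faces; c = 0 gives P itself. *)
Definition face P F : Prop := F !=set0 /\ exists c, F = maximizers P c.

Definition vertex P v : Prop := face P [set v].

Definition normal_cone P F : set 'rV[R]_n := [set c | F `<=` maximizers P c].

End Polyhedra.

Definition acyclic (V : finType) (e : rel V) : Prop :=
  forall s : seq V, cycle e s -> s = [::].

Definition edge (V : finType) (e : rel V) : finType :=
  {uv : V * V | e uv.1 uv.2} : finType.

(* The triple (I, J, L) stands for the CI statement [I _||_ J | L]. *)
Definition ci_statement (V : finType) : finType :=
  ({set V} * {set V} * {set V})%type.

Section Maxoids.
Context (R : realType) {V : finType} (e : rel V).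

(* A path i -> v_1 -> ... -> v_k = j is encoded by [:: v_1; ...; v_k], together
   with its source i. Its nodes are distinct, so k < #|V| and the length bound
   loses no path. *)
Definition paths (i j : V) : {set #|V|.-bseq V} :=
  [set p : #|V|.-bseq V | [&& path e i p, last i p == j & uniq (i :: p)]]%SET.

Definition path_edges (i : V) (p : seq V) : {set edge e} :=
  [set a | val a \in zip (i :: p) p]%SET.

Definition interior_nodes (i : V) (p : seq V) : seq V := behead (belast i p).

(* A weight matrix C supported on the graph is identified with the vector of
   its finite entries: c_uv is the entry of C at the rank of the edge (u, v). *)
Local Notation weights := 'rV[R]_#|edge e|.
Implicit Types (C : weights) (L : {set V}).

Definition path_weight C (i : V) (p : seq V) : R :=
  \sum_(a in path_edges i p) C 0 (enum_rank a).

Definition critical C (i j : V) (p : #|V|.-bseq V) : bool :=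
  (p \in paths i j) &&
  [forall q in paths i j, path_weight C i q <= path_weight C i p].

Definition generic C : Prop :=
  forall i j, i != j -> paths i j != finset.set0 ->
    exists! p, critical C i j p.

Definition critical_dag C L : rel V := fun i j =>
  [&& i != j, paths i j != finset.set0 &
      [forall p, critical C i j p ==>
                 ~~ has [in L] (interior_nodes i p)]].

(* The five forms (a)-(e), as paths from i to j with distinct nodes; only (a)
   and (d) are not symmetric in i and j. *)
Definition star_path C L (i j : V) : bool :=
  let g := critical_dag C L in
  [|| g i j,
      [exists p, [&& p \notin L, uniq [:: i; p; j], g p i & g p j]],
      [exists l, [&& l \in L, uniq [:: i; l; j], g i l & g j l]],
      [exists p, exists l,
         [&& p \notin L, l \in L, uniq [:: i; p; l; j],
             g p i, g p l & g j l]] |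
      [exists p, exists l, exists q,
         [&& p \notin L, l \in L, q \notin L, uniq [:: i; p; l; q; j],
             g p i, g p l, g q l & g q j]]].

Definition star_connected C L (i j : V) : bool :=
  star_path C L i j || star_path C L j i.

Definition star_separated C (I J L : {set V}) : bool :=
  [forall i in I, forall j in J, ~~ star_connected C L i j].

Definition maxoid C : {set ci_statement V} :=
  [set s : ci_statement V | let: (A, B, L) := s in
     [&& [disjoint A & B], [disjoint A & L], [disjoint B & L] &
         star_separated C A B L]]%SET.

Definition generic_maxoid (M : {set ci_statement V}) : Prop :=
  exists2 C, generic C & M = maxoid C.

Definition nongeneric_maxoid (M : {set ci_statement V}) : Prop :=
  exists2 C, ~ generic C & M = maxoid C.

(* The variable x_uv is indexed by the rank of the edge (u, v). *)
Definition path_polynomial (i j : V) : mpoly.mpoly #|edge e| R :=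
  \sum_(p in paths i j) \prod_(a in path_edges i p)
    @mpoly.mpolyX #|edge e| R (mpoly.mnm1 (enum_rank a)).

Definition exponent_vector n (m : mpoly.multinom n) : 'rV[R]_n :=
  \row_k (m k)%:R.

Definition newton_polytope n (f : mpoly.mpoly n R) : set 'rV[R]_n :=
  convex_hull [set exponent_vector m | m in [set` mpoly.msupp f]].

Definition maxoid_polytope : set weights :=
  minkowski_sum
    (fun ij : V * V => (ij.1 != ij.2) && (0 < #|paths ij.1 ij.2|)%N)
    (fun ij => newton_polytope (path_polynomial ij.1 ij.2)).

End Maxoids.

Arguments generic {R V} e C.
Arguments maxoid {R V} e C.
Arguments generic_maxoid R {V} e M.
Arguments nongeneric_maxoid R {V} e M.
Arguments maxoid_polytope R {V} e _.

(* Main.v *)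
(* The face of the maxoid polytope P maximizing C is the Minkowski sum of the hulls
   of the critical paths of C. Hence face(C) is contained in face(D) iff every
   C-critical path is D-critical, the normal cone of face(C) consists of all such D,
   and its relative interior of the D with the same critical paths as C; these
   determine the maxoid. face(C) is a point iff C is generic.

   It remains to recover the critical paths of a generic C from its maxoid. Let A be
   an ancestrally closed set with i in A and j not in A. Conditioning on A \ {i}
   leaves the single edge i -> j as the only possible connection, so i and j are
   connected iff the critical path from i to j leaves A at its first step. Taking for
   A the ancestors of i and k, for varying k, identifies the second node of that path;
   its tail is again critical, so induction recovers the whole path. *)
Require Import Defs.
From mathcomp Require Import all_boot all_order all_algebra.
From mathcomp Require Import all_classical all_reals all_analysis.
From mathcomp Require Import lra.
From mathcomp Require Import(canonicals, coercions) mpoly.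
Import Order.TTheory GRing.Theory Num.Theory.
Import numFieldNormedType.Exports.
Local Open Scope classical_set_scope.
Local Open Scope ring_scope.
Set Implicit Arguments.
Unset Strict Implicit.
Unset Printing Implicit Defensive.

(** * Inner products, convex hulls and positive dimension *)

Section InnerProduct.
Context {R : realType} {n : nat}.
Implicit Types (c x y : 'rV[R]_n) (A Q : set 'rV[R]_n).

Lemma inner_combr c x y (s t : R) :
  inner c (s *: x + t *: y) = s * inner c x + t * inner c y.
Proof.
rewrite /inner !mulr_sumr -big_split; apply: eq_bigr => k _.
by rewrite !mxE mulrDr mulrCA [c 0 k * (t * _)]mulrCA.
Qed.

Lemma innerC c x : inner c x = inner x c.
Proof. by apply: eq_bigr => k _; rewrite mulrC. Qed.

Lemma inner_combl c x y (s t : R) :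
  inner (s *: x + t *: y) c = s * inner x c + t * inner y c.
Proof. by rewrite innerC inner_combr !(innerC c). Qed.

Lemma inner_sumr (I : finType) (P : pred I) c (y : I -> 'rV[R]_n) :
  inner c (\sum_(i | P i) y i) = \sum_(i | P i) inner c (y i).
Proof.
rewrite /inner exchange_big; apply: eq_bigr => k _ /=.
by rewrite summxE mulr_sumr.
Qed.

Lemma convex_setI01 Q :
  (forall x y (t : R), 0 < t -> t < 1 -> Q x -> Q y -> Q (t *: x + (1 - t) *: y)) ->
  convex_set Q.
Proof.
move=> QQ; apply/convex_setW => x y /set_mem Qx /set_mem Qy k k0 k1.
by apply/mem_set; exact: QQ.
Qed.

(** The points with the concluding property form a convex set: a proper convex combination reaches
    the bound [h] only if both of its ends do. *)
Lemma convex_hull_extremal A Q c (h : R) : convex_set Q ->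
  (forall x, A x -> inner c x <= h) ->
  (forall x, A x -> inner c x = h -> Q x) ->
  forall x, convex_hull A x -> inner c x <= h /\ (inner c x = h -> Q x).
Proof.
move=> cQ Ah AQ; apply: smallest_sub; last by move=> x Ax; split; auto.
apply: convex_setI01 => x y t t0 t1 [xh xQ] [yh yQ].
have t1' : 0 < 1 - t by rewrite subr_gt0.
rewrite inner_combr; split=> [|E]; first by nra.
have [Ex Ey] : inner c x = h /\ inner c y = h by nra.
apply/set_mem; have /(_ (mem_set (xQ Ex)) (mem_set (yQ Ey))) :=
  cQ x y (Itv01 (ltW t0) (ltW t1)).
exact.
Qed.

Lemma dimension_gt0P A :
  (1 <= dimension A)%N <-> exists x y, [/\ A x, A y & x != y].
Proof.
split=> [|[x [y [Ax Ay xy]]]].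
  apply: contraPP => no; rewrite leqNgt => /negP; apply; rewrite ltnS.
  apply/bigmax_leqP => k /asboolP[y [yfree yA]].
  case: k y yfree yA => [[|k] kn] //= y yfree yA.
  exfalso; apply: no; exists (y (lift ord0 ord0)), (y ord0); split=> //.
  rewrite -subr_eq0; apply/negP => /eqP y0; move/row_freeP: yfree => [B].
  move/matrixP => /(_ ord0 ord0) /eqP.
  rewrite !mxE big1 => [|l _]; first by rewrite eq_sym oner_eq0.
  have := congr1 (fun v : 'rV[R]_n => v 0 l) y0.
  by rewrite !mxE => ->; rewrite mul0r.
(* Distinct points force [n] to be positive, so 1 is in the range of the maximum. For two points,
   affine independence says that a single row is nonzero. *)
have n0 : (1 < n.+1)%N.
  rewrite ltnS lt0n; apply: contra_neq xy => n0; apply/rowP => k.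
  by suff: (k < 0)%N by []; rewrite -[X in (_ < X)%N]n0.
rewrite /dimension; apply: (@leq_bigmax_cond _ _ _ (Ordinal n0)); apply/asboolP.
exists (fun k : 'I_2 => if k == ord0 then x else y); split=> [|k]; last by case: ifP.
rewrite /affinely_independent /row_free rank_rV eqb1.
apply: contra_neq xy => /rowP xy; apply/rowP => k.
by have := xy k; rewrite !mxE /= => /eqP; rewrite subr_eq0 => /eqP.
Qed.

End InnerProduct.

(** * Path vectors and Newton polytopes of path polynomials *)

Section Maxoids.
Context {R : realType} {V : finType} {e : rel V}.
Implicit Types (C D : 'rV[R]_#|edge e|) (i j : V) (A L : {set V}).
Local Notation connected_pairs :=
  (fun ij : V * V => (ij.1 != ij.2) && (0 < #|paths e ij.1 ij.2|)%N).
Local Notation newton i j := (newton_polytope (path_polynomial R e i j)).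
Local Notation P := (maxoid_polytope R e).

(** This is the exponent vector of the monomial of the path, so that weights of paths become linear
    functionals. *)
Definition path_vector i (p : seq V) : 'rV[R]_#|edge e| :=
  \row_k (enum_val k \in path_edges e i p)%:R.

Lemma inner_path_vector C i p : inner C (path_vector i p) = path_weight C i p.
Proof.
rewrite /inner /path_weight [RHS]big_mkcond [RHS](reindex_onto enum_val enum_rank) /=.
  apply: eq_big => [k|k _]; first by rewrite enum_valK eqxx.
  by rewrite mxE enum_valK; case: ifP => _; rewrite ?mulr1 ?mulr0.
by move=> a _; rewrite enum_rankK.
Qed.

Lemma mem_zip_path i (p : seq V) u v : path e i p -> (u, v) \in zip (i :: p) p -> e u v.
Proof.
elim: p i => [|s p IH] i //= /andP[eis ep].
by rewrite inE => /orP[/eqP[-> ->] //|]; exact: IH.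
Qed.

Lemma mem_zip_source i (p : seq V) u v : (u, v) \in zip (i :: p) p -> u \in i :: p.
Proof.
elim: p i => [|s p IH] i //=.
rewrite inE => /orP[/eqP[-> _]|]; first by rewrite mem_head.
by move/IH; rewrite [_ \in i :: _]inE => ->; rewrite orbT.
Qed.

(** Weights are sums over sets of edges, so the first edge must not recur: every later edge has its
    source in [s :: p], which avoids [i]. *)
Lemma path_weight_cons C i s (p : seq V) : i \notin s :: p ->
  path_weight C i (s :: p) = path_weight C i [:: s] + path_weight C s p.
Proof.
move=> ip; rewrite /path_weight -bigU /=; last first.
  rewrite disjoint_subset; apply/fintype.subsetP => -[[u v] uv].
  rewrite !inE /= => /eqP[-> _].
  by apply: contra ip => /mem_zip_source.
by apply: eq_bigl => a; rewrite !inE.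
Qed.

(** The set of edges forgets their order, but the nodes are distinct, so only the first edge has
    source [i]. It gives the second node, and the tails are compared in the same way. *)
Lemma path_edges_inj i (p q : seq V) : path e i p -> path e i q ->
  uniq (i :: p) -> uniq (i :: q) ->
  path_edges e i p = path_edges e i q -> p = q.
Proof.
move=> pp pq up uq E.
have {E} : forall uv, (uv \in zip (i :: p) p) = (uv \in zip (i :: q) q).
  move=> [u v]; apply/idP/idP => H.
    have euv := mem_zip_path pp H.
    have := finset.in_set (fun a : edge e => val a \in zip (i :: p) p) (Sub (u, v) euv).
    by rewrite -/(path_edges e i p) E inE SubK H => ->.
  have euv := mem_zip_path pq H.
  have := finset.in_set (fun a : edge e => val a \in zip (i :: q) q) (Sub (u, v) euv).
  by rewrite -/(path_edges e i q) -E inE SubK H => ->.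
elim: p q i {pp pq} up uq => [|s p IH] [|t q] i up uq E //.
- by have := E (i, t); rewrite /= mem_head.
- by have := E (i, s); rewrite /= mem_head.
have st : s = t.
  have := E (i, s); rewrite /= !inE eqxx /= => /esym/orP[/eqP[]//|/mem_zip_source].
  by case/andP: uq => /negbTE ->.
subst t; congr (_ :: _); apply: (IH _ s).
- by case/andP: up.
- by case/andP: uq.
move=> [u v]; have := E (u, v); rewrite /= !inE xpair_eqE.
case: (eqVneq u i) => [->|_] //= _.
apply/idP/idP => /mem_zip_source; last by case/andP: uq => /negbTE ->.
by case/andP: up => /negbTE ->.
Qed.

(** A coefficient counts the paths with the given monomial. In characteristic 0 nothing cancels, so
    the support consists of the monomials of all paths. *)
Lemma newton_path_polynomialE i j :
  newton_polytope (path_polynomial R e i j) =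
  convex_hull [set path_vector i p | p in [set` paths e i j]].
Proof.
rewrite /newton_polytope; congr (convex_hull _).
pose m (p : seq V) : mpoly.multinom #|edge e| :=
  \big[mpoly.mnm_add/mpoly.mnm0]_(a in path_edges e i p) mpoly.mnm1 (enum_rank a).
have vm p : exponent_vector R (m p) = path_vector i p.
  apply/rowP => k; rewrite !mxE /m mpoly.mnm_sumE.
  congr (_%:R); case: (boolP (enum_val k \in _)) => [kp|kNp].
    rewrite (bigD1 (enum_val k)) //= mpoly.mnm1E enum_valK eqxx big1 // => a /andP[_ ak].
    by rewrite mpoly.mnm1E -(inj_eq enum_val_inj) enum_rankK (negbTE ak).
  rewrite big1 // => a ap; rewrite mpoly.mnm1E -(inj_eq enum_val_inj) enum_rankK.
  by case: eqP => // E; rewrite -E ap in kNp.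
have fE : path_polynomial R e i j = \sum_(p in paths e i j) mpoly.mpolyX R (m p).
  by apply: eq_bigr => p _; rewrite mpoly.mprodXE.
have fm mu : (mu \in mpoly.msupp (path_polynomial R e i j)) =
    [exists p in paths e i j, m p == mu].
  rewrite mpoly.mcoeff_msupp fE raddf_sum /=.
  under eq_bigr do rewrite mpoly.mcoeffX.
  rewrite -natr_sum pnatr_eq0 sum_nat_eq0 negb_forall.
  by apply: eq_existsb => p; rewrite negb_imply; case: (m p == mu).
apply/seteqP; split=> x [/= mu].
  rewrite fm => /exists_inP[p pP /eqP E] <-; exists p => //.
  by rewrite -E vm.
move=> muP <-; exists (m mu) => //=.
by rewrite fm; apply/exists_inP; exists mu.
Qed.

(** * Critical paths and the faces of the maxoid polytope *)

Lemma critical_exists C i j : paths e i j != finset.set0 ->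
  exists p, critical C i j p.
Proof.
case/set0Pn => p0 p0P; pose w (p : #|V|.-bseq V) := path_weight C i p.
case: (arg_maxP w p0P) => p pP pmax; exists p.
by apply/andP; split=> //; apply/forall_inP => q; exact: pmax.
Qed.

(** The default, the empty sequence, is returned only when there is no path from [i] to [j]. *)
Definition critical_path C i j : #|V|.-bseq V :=
  if [pick p | critical C i j p] is Some p then p else insub_bseq _ [::].

Lemma critical_pathP C i j : (0 < #|paths e i j|)%N ->
  critical C i j (critical_path C i j).
Proof.
rewrite card_gt0 => /(critical_exists C)[p pC]; rewrite /critical_path.
by case: pickP => // /(_ p); rewrite pC.
Qed.

Definition critical_weight C i j : R := path_weight C i (critical_path C i j).

Lemma path_weight_le C i j p : p \in paths e i j ->
  path_weight C i p <= critical_weight C i j.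
Proof.
move=> pP; have /(critical_pathP C)/andP[_ /forall_inP] : (0 < #|paths e i j|)%N.
  by apply/card_gt0P; exists p.
exact.
Qed.

Lemma criticalE C i j p : critical C i j p =
  (p \in paths e i j) && (path_weight C i p == critical_weight C i j).
Proof.
rewrite /critical; apply: andb_id2l => pP; rewrite eq_le path_weight_le //=.
apply/forall_inP/idP => [|le q qP]; last exact: le_trans (path_weight_le _ _) le.
apply; have /(critical_pathP C)/andP[] // : (0 < #|paths e i j|)%N.
by apply/card_gt0P; exists p.
Qed.

Lemma path_vector_newton i j p : p \in paths e i j ->
  newton i j (path_vector i p).
Proof.
by move=> pP; rewrite newton_path_polynomialE; apply: sub_gen_smallest; exists p.
Qed.

(** The face of the Newton polytope maximizing [C] lies in the hull of the critical paths; an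
    arbitrary convex [Q] stands in for that hull. *)
Lemma newton_extremal C Q i j : convex_set Q ->
  (forall p, critical C i j p -> Q (path_vector i p)) ->
  forall x, newton i j x -> inner C x = critical_weight C i j -> Q x.
Proof.
move=> cQ CQ x; rewrite newton_path_polynomialE => xN.
apply: (convex_hull_extremal cQ _ _ xN).2 => _ [p /= pP <-]; rewrite inner_path_vector.
  exact: path_weight_le.
by move/eqP => E; apply: CQ; rewrite criticalE pP.
Qed.

Lemma newton_le C i j x : newton i j x -> inner C x <= critical_weight C i j.
Proof.
rewrite newton_path_polynomialE => xN.
apply: (convex_hull_extremal (Q := setT) _ _ _ xN).1 => //.
by move=> _ [p /= pP <-]; rewrite inner_path_vector; exact: path_weight_le.
Qed.

(** Each summand is bounded by the critical weight of its pair, and choosing a critical path for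
    every pair attains all these bounds at once. A maximal sum therefore has no slack in any
    summand. *)
Lemma maximizers_sum C (y : V * V -> 'rV[R]_#|edge e|) :
  (forall ij, connected_pairs ij -> newton ij.1 ij.2 (y ij)) ->
  maximizers P C (\sum_(ij | connected_pairs ij) y ij) <->
  forall ij, connected_pairs ij -> inner C (y ij) = critical_weight C ij.1 ij.2.
Proof.
move=> yN; split=> [[_ ymax] ij ijP|yE].
  apply: le_anti; rewrite newton_le /=; last exact: yN.
  pose z (ij : V * V) := path_vector ij.1 (critical_path C ij.1 ij.2).
  have zN : forall ij, connected_pairs ij -> newton ij.1 ij.2 (z ij).
    move=> [u v] /andP[_ /(critical_pathP C)]; rewrite criticalE => /andP[+ _].
    exact: path_vector_newton.
  have := ymax (\sum_(ij | connected_pairs ij) z ij); rewrite !inner_sumr.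
  have zP : P (\sum_(ij | connected_pairs ij) z ij) by exists z.
  move=> /(_ zP); rewrite (bigD1 ij) // [leRHS](bigD1 ij) //= inner_path_vector.
  rewrite -/(critical_weight _ _ _) => le.
  rewrite -(lerD2r (\sum_(i | connected_pairs i && (i != ij)) inner C (z i))).
  apply: (le_trans le); rewrite lerD2l; apply: ler_sum => i /andP[iP _].
  by rewrite [leRHS]inner_path_vector; exact: newton_le (yN _ iP).
split=> [|x [z zN ->]]; first by exists y.
rewrite !inner_sumr; apply: ler_sum => ij ijP; rewrite yE //.
exact: newton_le (zN _ ijP).
Qed.

Definition critical_sub C D : Prop :=
  forall i j p, i != j -> critical C i j p -> critical D i j p.

(* The summands of a point of the polytope: p for the pair (i, j), some critical
   path for every other pair. *)
Definition path_choice C i j (p : #|V|.-bseq V) (uv : V * V) : 'rV[R]_#|edge e| :=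
  path_vector uv.1 (if uv == (i, j) then p else critical_path C uv.1 uv.2).

Lemma critical_pair C i j p : i != j -> critical C i j p -> connected_pairs (i, j).
Proof.
by move=> ij /andP[pP _]; rewrite /= ij; apply/card_gt0P; exists p.
Qed.

Lemma path_choice_critical C i j p : critical C i j p ->
  forall ij, connected_pairs ij ->
    critical C ij.1 ij.2 (if ij == (i, j) then p else critical_path C ij.1 ij.2).
Proof.
move=> pC [u v] /andP[_ ?] /=; case: eqP => [[-> ->] //|_].
exact: critical_pathP.
Qed.

Lemma path_choice_newton C i j p : critical C i j p ->
  forall ij, connected_pairs ij -> newton ij.1 ij.2 (path_choice C i j p ij).
Proof.
move=> pC ij ijP; apply: path_vector_newton.
by have /andP[] := path_choice_critical pC ijP.
Qed.

Lemma maximizers_path_choice C i j p : critical C i j p ->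
  maximizers P C (\sum_(ij | connected_pairs ij) path_choice C i j p ij).
Proof.
move=> pC; apply/maximizers_sum; first exact: path_choice_newton.
move=> ij ijP; rewrite inner_path_vector; apply/eqP.
by have := path_choice_critical pC ijP; rewrite criticalE => /andP[].
Qed.

(** Forwards, a critical path [p] is tested on a point of the face that has [p] as a summand.
    Backwards, [D] is constant on the hull of the [C]-critical paths of a pair. *)
Lemma maximizers_subP C D : maximizers P C `<=` maximizers P D <-> critical_sub C D.
Proof.
split=> [CD i j p ij pC|CD x [[y yN ->] ymax]].
  have /(maximizers_sum _ (path_choice_newton pC)) := CD _ (maximizers_path_choice pC).
  move=> /(_ _ (critical_pair ij pC)); rewrite inner_path_vector eqxx /= => pE.
  by rewrite criticalE pE eqxx andbT; case/andP: pC.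
have /(maximizers_sum _ yN) yE : maximizers P C (\sum_(ij | connected_pairs ij) y ij).
  by split=> //; exists y.
apply/(maximizers_sum _ yN) => -[i j] ijP; have /andP[/= ij _] := ijP.
apply: (newton_extremal (Q := [set x | inner D x = critical_weight D i j])
  _ _ (yN _ ijP) (yE _ ijP)).
  apply: convex_setI01 => a b t _ _ /= aE bE.
  by rewrite inner_combr aE bE -mulrDl addrC subrK mul1r.
move=> p /(CD _ _ _ ij); rewrite criticalE /= inner_path_vector => /andP[_].
by move/eqP.
Qed.

Lemma normal_coneP C D : normal_cone P (maximizers P C) D <-> critical_sub C D.
Proof. exact: maximizers_subP. Qed.

Lemma maximizers_neq0 C : maximizers P C !=set0.
Proof.
pose y (ij : V * V) := path_vector ij.1 (critical_path C ij.1 ij.2) : 'rV[R]_#|edge e|.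
exists (\sum_(ij | connected_pairs ij) y ij).
apply/maximizers_sum => ij /andP[_ /(critical_pathP C)].
  by case/andP => + _; exact: path_vector_newton.
by rewrite /y inner_path_vector.
Qed.

(** Two critical paths of one pair give points of the face that differ in that summand only; if the
    points agree, so do the edge sets and hence the paths. Conversely, unique critical paths shrink
    every summand to a point. *)
Lemma maximizers_set1P C : (exists v, maximizers P C = [set v]) <-> generic e C.
Proof.
split=> [[v Cv] i j ij /(critical_exists C)[p pC]|Cgen].
  exists p; split=> // q qC.
  have sub k : critical C i j k ->
      \sum_(ij | connected_pairs ij) path_choice C i j k ij = v.
    by move/maximizers_path_choice; rewrite Cv.
  have := sub _ pC; rewrite -(sub _ qC) (bigD1 (i, j)) ?(critical_pair ij pC) //=.
  rewrite [RHS](bigD1 (i, j)) ?(critical_pair ij pC) //= [X in _ + X](_ : _ =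
    \sum_(k | connected_pairs k && (k != (i, j))) path_choice C i j q k).
    move/addIr; rewrite /path_choice eqxx /= => E.
    case/andP: pC qC; rewrite !inE => /and3P[pp _ up] _ /andP[].
    rewrite !inE => /and3P[pq _ uq] _.
    apply/val_inj/(path_edges_inj pp pq up uq)/setP => a.
    have := congr1 (fun x : 'rV[R]_#|edge e| => x 0 (enum_rank a)) E.
    by rewrite !mxE enum_rankK => /eqP; rewrite eqr_nat => /eqP; do 2!case: (a \in _).
  by apply: eq_bigr => k /andP[_ /negbTE kij]; rewrite /path_choice kij.
pose y (ij : V * V) := path_vector ij.1 (critical_path C ij.1 ij.2) : 'rV[R]_#|edge e|.
exists (\sum_(ij | connected_pairs ij) y ij).
have sub x : maximizers P C x -> x = \sum_(ij | connected_pairs ij) y ij.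
  case=> [[z zN ->] zmax]; apply: eq_bigr => -[i j] ijP.
  have /(maximizers_sum _ zN) zE : maximizers P C (\sum_(ij | connected_pairs ij) z ij).
    by split=> //; exists z.
  apply: (newton_extremal (Q := [set y (i, j)]) _ _ (zN _ ijP) (zE _ ijP)).
    apply: convex_setI01 => a b t _ _ /= -> ->.
    by rewrite -scalerDl addrC subrK scale1r.
  have /andP[/= ij ijN] := ijP.
  move: (ijN); rewrite card_gt0 => /(Cgen _ _ ij)[q [_ qu]].
  by move=> p pC; rewrite /= /y /= -(qu _ pC) -(qu _ (critical_pathP C ijN)).
apply/seteqP; split=> [x /sub -> //|_ ->].
by have [x xC] := maximizers_neq0 C; rewrite -(sub _ xC).
Qed.

(** * Interiors of normal cones *)

Lemma path_weight_continuous i (p : seq V) :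
  continuous (fun C : 'rV[R]_#|edge e| => path_weight C i p).
Proof.
move=> C; apply: (cvg_big (@add_continuous _) (F := nbhs C) _) => a _.
exact: coord_continuous.
Qed.

Lemma path_weight_comb C D i (p : seq V) (s t : R) :
  path_weight (s *: C + t *: D) i p = s * path_weight C i p + t * path_weight D i p.
Proof. by rewrite -!inner_path_vector inner_combl. Qed.

(* A path that is not critical for C is beaten strictly, which persists near C. *)
Lemma near_critical_sub C : \forall D \near C, critical_sub D C.
Proof.
have near1 ijp : \forall D \near C,
    critical D ijp.1.1 ijp.1.2 ijp.2 -> critical C ijp.1.1 ijp.1.2 ijp.2.
  case: ijp => -[i j] p /=.
  have [pC|] := boolP (critical C i j p); first by apply: (nearW (F := nbhs C)).
  rewrite criticalE; have [pP /=|pP _] := boolP (p \in paths e i j); last first.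
    by apply: (nearW (F := nbhs C)) => D /andP[]; rewrite (negbTE pP).
  move=> wp; pose q := critical_path C i j.
  have qP : q \in paths e i j.
    have /(critical_pathP C)/andP[] // : (0 < #|paths e i j|)%N.
    by apply/card_gt0P; exists p.
  have pq : 0 < path_weight C i q - path_weight C i p.
    by rewrite subr_gt0 lt_neqAle wp; exact: path_weight_le.
  have : path_weight D i q - path_weight D i p @[D --> C] -->
      path_weight C i q - path_weight C i p.
    exact: (cvgB (@path_weight_continuous i q C) (@path_weight_continuous i p C)).
  move=> /cvgr_gt/(_ _ pq); apply: filterS => D; rewrite subr_gt0 => lt.
  by case/andP=> _ /forall_inP/(_ _ qP); rewrite leNgt lt.
(* The triples form a finite type, so their neighbourhoods have a common one. *)
near=> D => i j p _; have : forall ijp : V * V * #|V|.-bseq V,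
    critical D ijp.1.1 ijp.1.2 ijp.2 -> critical C ijp.1.1 ijp.1.2 ijp.2.
  by near: D; exact: filter_forall.
by move/(_ (i, j, p)).
Unshelve. all: by end_near. Qed.

(** Equality of two path weights is an affine condition on the matrix, so it passes from the cone to
    its affine hull. *)
Lemma affine_hull_normal_cone C i j p q : i != j ->
  critical C i j p -> critical C i j q ->
  forall D', affine_hull (normal_cone P (maximizers P C)) D' ->
  path_weight D' i p = path_weight D' i q.
Proof.
move=> ij pC qC; apply: smallest_sub => [x y u /= xE yE|x /normal_coneP xC].
  by rewrite !path_weight_comb xE yE.
have := xC _ _ _ ij pC; have := xC _ _ _ ij qC.
by rewrite !criticalE => /andP[_ /eqP ->] /andP[_ /eqP ->].
Qed.

Lemma relative_interior_normal_coneP C D :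
  relative_interior (normal_cone P (maximizers P C)) D <->
  critical_sub C D /\ critical_sub D C.
Proof.
split=> [[/normal_coneP CD]|[CD DC]].
  rewrite /within /= => nD; split=> // i j q ij qD.
  (* Move slightly beyond D on the line from C: a path critical for D but not for
     C would beat the C-critical ones there. *)
  pose phi (t : R) := (1 + t) *: D + (1 - (1 + t)) *: C.
  have phi0 : phi t @[t --> 0] --> D.
    have -> : D = phi 0 by rewrite /phi addr0 subrr scale1r scale0r addr0.
    apply: cvgD; apply: cvgZr_tmp; first by apply: cvgD; [exact: cvg_cst|exact: cvg_id].
    apply: cvgB; first exact: cvg_cst.
    by apply: cvgD; [exact: cvg_cst|exact: cvg_id].
  have : \forall t \near (0 : R)^'+,
    affine_hull (normal_cone P (maximizers P C)) (phi t) ->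
    normal_cone P (maximizers P C) (phi t) by exact: (cvg_at_right_filter phi0) _ nD.
  have phi_aff t : affine_hull (normal_cone P (maximizers P C)) (phi t).
    move=> B [Baff BN]; apply: Baff; apply: BN; exact/normal_coneP.
  have tpos : \forall t \near (0 : R)^'+, 0 < t by exact: nbhs_right_gt.
  move=> /(filterI tpos)/filter_ex[t [t0 /(_ (phi_aff t))/normal_coneP Ct]].
  have ijN : (0 < #|paths e i j|)%N.
    by case/andP: qD => qP _; apply/card_gt0P; exists q.
  have pC := critical_pathP C ijN; set p := critical_path C i j in pC.
  have pt := Ct _ _ _ ij pC; have pD := CD _ _ _ ij pC.
  case/andP: (qD) => qP _; case/andP: pt => _ /forall_inP/(_ _ qP).
  move: qD pD pC; rewrite !criticalE qP !path_weight_comb.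
  move=> /andP[_ /eqP ->] /andP[_ /eqP ->] /andP[pP /eqP ->].
  (* The [D]-weights of [p] and [q] cancel. What remains are the [C]-weights with factor [- t],
     which reverses the comparison. *)
  rewrite lerD2l opprD addrA subrr sub0r !mulNr lerN2 ler_pM2l // => le.
  by rewrite eq_le path_weight_le.
split; first exact/normal_coneP.
(* Near [D], some [C]-critical path is [D']-critical; within the affine hull, all other [C]-critical
   paths of the pair have the same [D']-weight. *)
apply: filterS (near_critical_sub D) => D' D'D D'aff; apply/normal_coneP => i j p ij pC.
have ijN : (0 < #|paths e i j|)%N.
  by case/andP: pC => pP _; apply/card_gt0P; exists p.
have qD' := critical_pathP D' ijN; have qC := DC _ _ _ ij (D'D _ _ _ ij qD').
rewrite criticalE; case/andP: (pC) => -> _ /=.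
rewrite (affine_hull_normal_cone ij pC qC D'aff).
by move: qD'; rewrite criticalE => /andP[].
Qed.

(** With only one [C]-critical path for each pair, there are no ties to preserve, so the argument
    for the relative interior works in a full neighbourhood. *)
Lemma interior_normal_coneP C D : generic e C ->
  interior (normal_cone P (maximizers P C)) D <->
  critical_sub C D /\ critical_sub D C.
Proof.
move=> Cgen; split=> [CD|[CD DC]].
  apply/relative_interior_normal_coneP; split; first exact: interior_subset.
  by apply: filterS CD => x.
apply: filterS (near_critical_sub D) => D' D'D; apply/normal_coneP => i j p ij pC.
have ijN : (0 < #|paths e i j|)%N.
  by case/andP: pC => pP _; apply/card_gt0P; exists p.
have qD' := critical_pathP D' ijN; have qC := DC _ _ _ ij (D'D _ _ _ ij qD').
move: (ijN); rewrite card_gt0 => /(Cgen _ _ ij)[r [_ ru]].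
by rewrite -(ru _ pC) (ru _ qC).
Qed.

(** * Recovering critical paths from a generic maxoid *)

Lemma pathsP i j (p : #|V|.-bseq V) :
  reflect [/\ path e i p, last i p = j & uniq (i :: p)] (p \in paths e i j).
Proof. by rewrite !inE; apply: (iffP and3P) => -[? /eqP]. Qed.

Lemma paths_connect i j (p : #|V|.-bseq V) : p \in paths e i j -> connect e i j.
Proof. by case/pathsP => ep lp _; apply/connectP; exists p. Qed.

Lemma connect_anti u v : acyclic e -> connect e u v -> connect e v u -> u = v.
Proof.
move=> dag /connectP[p ep ->] /connectP[q eq lq].
have epq : path e u (p ++ q) by rewrite cat_path ep.
have lpq : last u (p ++ q) = u by rewrite last_cat -lq.
case: (lastP (p ++ q)) (size_cat p q) epq lpq => [|r x].
  by case: p {ep eq lq}.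
by rewrite last_rcons => _ + E; rewrite E => er; have := dag (u :: r) er.
Qed.

Lemma paths_refl i (p : #|V|.-bseq V) : p \in paths e i i -> p = [::] :> seq V.
Proof.
case/pathsP; case: (p : seq V) => //= u r _ lr /andP[+ _].
by rewrite -{1}lr mem_last.
Qed.

Definition ancestral A : Prop := forall u v, connect e u v -> v \in A -> u \in A.

Lemma critical_dag_connect C L u v : critical_dag C L u v -> u != v /\ connect e u v.
Proof. by case/and3P => uv /set0Pn[p /paths_connect]. Qed.

(* Each of the forms (b)-(e), in either direction, needs a node outside A \ {i}, other
   than i, that is an ancestor of a node of A, or a descendant of j in A. *)
Lemma star_connected_ancestral C A i j : ancestral A -> i \in A -> j \notin A ->
  star_connected C (A :\ i) i j = critical_dag C (A :\ i) i j.
Proof.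
move=> Aanc iA jA.
have gA u v : critical_dag C (A :\ i) u v -> v \in A -> u \in A.
  by case/critical_dag_connect => _ /Aanc; apply.
have gL p v : p \notin A :\ i -> p != i -> critical_dag C (A :\ i) p v -> v \notin A.
  by move=> pL pi g; apply: contra pL => /(gA _ _ g) pA; rewrite !inE pi.
have gj l : l \in A :\ i -> critical_dag C (A :\ i) j l -> false.
  by rewrite !inE => /andP[_ lA] /gA /(_ lA); rewrite (negbTE jA).
have gi p : p \notin A :\ i -> critical_dag C (A :\ i) p i -> false.
  move=> pL g; have [pi _] := critical_dag_connect g.
  by have := gL _ _ pL pi g; rewrite iA.
have LA l : l \in A :\ i -> l \in A by rewrite !inE => /andP[].
rewrite /star_connected /star_path; apply/idP/idP => [|-> //].
case/orP => /orP[] // => [/or4P[/existsP[p]|/existsP[l]|/existsP[p /existsP[l]]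
  |/existsP[p /existsP[l /existsP[q]]]]||/or4P[/existsP[p]|/existsP[l]
  |/existsP[p /existsP[l]]|/existsP[p /existsP[l /existsP[q]]]]].
(* Forms (b) to (e) from [i] to [j], followed by (a) to (e) from [j] to [i]. *)
- by case/and4P => /gi + _ /[swap] _ => /[apply].
- by case/and4P => /gj + _ _ => /[apply].
- by case/and5P => _ /gj + _ _ /andP[_] => /[apply].
- by case/and5P => /gi + _ _ _ /and4P[] => /[apply].
- by move/gA => /(_ iA); rewrite (negbTE jA).
- by case/and4P => /gi + _ _ => /[apply].
- by case/and4P => /gj + _ + _ => /[apply].
- case/and5P => pL lL; rewrite /= !inE => /and4P[_ + _ _] _ /andP[gpl _].
  rewrite negb_or => /andP[_ pi].
  by have := gL _ _ pL pi gpl; rewrite LA.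
- by case/and5P => _ _ /gi + _ /and4P[_ _ _] => /[apply].
Qed.

Lemma maxoid_ancestral C A i j : ancestral A -> i \in A -> j \notin A ->
  (([set i], [set j], A :\ i)%SET \in maxoid e C) = ~~ critical_dag C (A :\ i) i j.
Proof.
move=> Aanc iA jA; rewrite inE -(star_connected_ancestral C Aanc iA jA).
have ij : i != j by apply: contraNneq jA => <-.
rewrite !disjoints1 !inE eqxx (negbTE jA) andbF (negbTE ij) /=.
apply/forall_inP/idP => [/(_ i)|ncon _ /set1P ->].
  by rewrite inE eqxx => /(_ isT)/forall_inP/(_ j); rewrite inE eqxx; exact.
by apply/forall_inP => _ /set1P ->.
Qed.

(** The second node [s] is an ancestor of every interior node, so the critical path meets the
    ancestral set after [i] only if [s] is in it. *)
Lemma critical_dag_ancestral C A i j s (p : seq V) (sp : #|V|.-bseq V) :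
  generic e C -> i != j -> sp = s :: p :> seq V -> critical C i j sp ->
  ancestral A -> i \in A -> j \notin A ->
  critical_dag C (A :\ i) i j = (s \notin A).
Proof.
move=> Cgen ij spE pC Aanc iA jA.
have [/[dup] spP /pathsP[esp lsp usp] _] := andP pC.
have ijN : paths e i j != finset.set0 by apply/set0Pn; exists sp.
have [r [_ ru]] := Cgen _ _ ij ijN.
have -> : critical_dag C (A :\ i) i j = ~~ has [in A :\ i] (interior_nodes i sp).
  rewrite /critical_dag ij ijN /=; apply/forall_inP/idP => [|? q qC]; first exact.
  by rewrite -(ru _ qC) (ru _ pC).
move: esp lsp usp; rewrite spE /interior_nodes /= => /andP[eis ep] lsp /andP[].
rewrite inE negb_or => /andP[si ip] _; congr (~~ _).
apply/idP/idP => [/hasP[v vp]|sA].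
  rewrite !inE => /andP[_]; apply: Aanc.
  by apply: (path_connect ep); exact: mem_belast vp.
apply/hasP; exists s; last by rewrite !inE sA eq_sym si.
(* As [s] is in [A] and [j] is not, [s] is not the last node, hence it is interior. *)
by case: p lsp {spE ep ip} => [sj|t p _]; [rewrite -sj /= sA in jA|rewrite mem_head].
Qed.

Lemma paths_seq i j (p : seq V) : path e i p -> last i p = j -> uniq (i :: p) ->
  exists2 q : #|V|.-bseq V, q \in paths e i j & q = p :> seq V.
Proof.
move=> ep lp up; have sp : (size p <= #|V|)%N.
  by apply: (leq_trans (leqnSn _)); rewrite -/(size (i :: p)) -(card_uniqP up) max_card.
by exists (Bseq sp) => //; apply/pathsP.
Qed.

Lemma acyclic_notin i (p : seq V) : acyclic e -> path e i p -> i \notin p.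
Proof.
move=> dag ep; apply/negP => ip; case/splitPr: ip ep => p1 p2.
rewrite cat_path /= => /and3P[ep1 e1 _].
by have := dag (i :: p1); rewrite /= rcons_path ep1 e1 => /(_ isT).
Qed.

(** A heavier path from [s] could be prefixed by the edge from [i]; by acyclicity it avoids [i], so
    the result would be a path beating [sp]. *)
Lemma critical_behead C i j s (p : seq V) (sp : #|V|.-bseq V) :
  acyclic e -> critical C i j sp -> sp = s :: p :> seq V ->
  exists2 q : #|V|.-bseq V, critical C s j q & q = p :> seq V.
Proof.
move=> dag /andP[/pathsP[+ + +] spmax] spE.
rewrite spE /= => /andP[eis ep] lp /andP[ip up].
have [q qP qE] := paths_seq ep lp up; exists q => //; rewrite /critical qP /=.
apply/forall_inP => r /pathsP[er lr ur].
have eir : path e i (s :: r) by rewrite /= eis.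
have ir := acyclic_notin dag eir.
have [|sr srP srE] := paths_seq eir lr; first by rewrite cons_uniq ir ur.
have := forall_inP spmax _ srP; rewrite srE spE qE.
by rewrite !(path_weight_cons _ ir) (path_weight_cons _ ip) lerD2l.
Qed.

Lemma critical_head_connect C D i j s t (p q : seq V) (sp tq : #|V|.-bseq V) :
  acyclic e -> generic e C -> generic e D -> maxoid e C = maxoid e D ->
  i != j -> critical C i j sp -> critical D i j tq ->
  sp = s :: p :> seq V -> tq = t :: q :> seq V ->
  s != j -> connect e t s.
Proof.
move=> dag Cgen Dgen CD ij spC tqD spE tqE sj.
(* This set contains [s], so by the equality of maxoids it contains [t]. The edge from [i] to [t]
   excludes that [t] is an ancestor of [i]. *)
pose A := [set u | connect e u i || connect e u s]%SET.
have Aanc : ancestral A.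
  by move=> u v uv; rewrite !inE => /orP[|] /(connect_trans uv) ->; rewrite ?orbT.
have iA : i \in A by rewrite inE connect0.
have /andP[/[dup] /paths_connect cij /pathsP[+ + _] _] := spC.
rewrite spE /= => /andP[_ ep] lp.
have jA : j \notin A.
  rewrite inE negb_or; apply/andP; split; apply/negP => cj.
    by rewrite (connect_anti dag cij cj) eqxx in ij.
  suff sj' : s = j by rewrite sj' eqxx in sj.
  have csj : connect e s j by apply/connectP; exists p.
  exact: connect_anti dag csj cj.
have := maxoid_ancestral D Aanc iA jA.
rewrite -CD (maxoid_ancestral C Aanc iA jA) => /negb_inj.
rewrite (critical_dag_ancestral Dgen ij tqE tqD Aanc iA jA).
rewrite (critical_dag_ancestral Cgen ij spE spC Aanc iA jA).
move=> /negb_inj; rewrite !inE connect0 orbT => /esym/orP[ti|//].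
have /andP[/pathsP[+ _ +] _] := tqD.
rewrite tqE /= inE negb_or => /andP[eit _] /andP[/andP[it _] _].
by rewrite (connect_anti dag (connect1 eit) ti) eqxx in it.
Qed.

(** The two second nodes reach each other, so acyclicity identifies them. When one of them is [j],
    where [critical_head_connect] does not apply, the other reaches it along its own path. *)
Lemma critical_head_eq C D i j s t (p q : seq V) (sp tq : #|V|.-bseq V) :
  acyclic e -> generic e C -> generic e D -> maxoid e C = maxoid e D ->
  i != j -> critical C i j sp -> critical D i j tq ->
  sp = s :: p :> seq V -> tq = t :: q :> seq V -> s = t.
Proof.
move=> dag Cgen Dgen CD ij spC tqD spE tqE.
have ts := critical_head_connect dag Cgen Dgen CD ij spC tqD spE tqE.
have st := critical_head_connect dag Dgen Cgen (esym CD) ij tqD spC tqE spE.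
have sj : connect e s j.
  by have [q' /andP[/paths_connect]] := critical_behead dag spC spE.
have tj : connect e t j.
  by have [q' /andP[/paths_connect]] := critical_behead dag tqD tqE.
have [E|/ts cts] := eqVneq s j; have [E'|/st cst] := eqVneq t j.
- by rewrite E.
- by rewrite -E in tj; exact: connect_anti dag cst tj.
- by rewrite -E' in sj; exact: connect_anti dag sj cts.
- exact: connect_anti dag cst cts.
Qed.

Lemma maxoid_critical C D : acyclic e -> generic e C -> generic e D ->
  maxoid e C = maxoid e D -> critical_sub C D.
Proof.
move=> dag Cgen Dgen CD i j p ij pC; have [n pn] := ubnP (size p).
elim: n => [|n IH] in i p ij pC pn *; first by case/negP: (ltn0 (size p)).
have ijN : (0 < #|paths e i j|)%N.
  by case/andP: pC => pP _; apply/card_gt0P; exists p.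
have qD := critical_pathP D ijN; set q := critical_path D i j in qD.
suff -> : p = q by [].
case pE : (p : seq V) => [|s p'].
  by move: pC ij => /andP[/pathsP[_ + _] _]; rewrite pE /= => ->; rewrite eqxx.
case qE : (q : seq V) => [|t q'].
  by move: qD ij => /andP[/pathsP[_ + _] _]; rewrite qE /= => ->; rewrite eqxx.
have st := critical_head_eq dag Cgen Dgen CD ij pC qD pE qE; subst t.
have [p1 p1C p1E] := critical_behead dag pC pE.
have [q1 q1D q1E] := critical_behead dag qD qE.
apply/val_inj; rewrite /= pE qE -p1E -q1E; congr (_ :: _).
(* Genericity speaks of distinct nodes only; if [s] is [j], both tails are empty. *)
have [sj|sj] := eqVneq s j.
  rewrite sj in p1C q1D.
  by rewrite (paths_refl (andP p1C).1) (paths_refl (andP q1D).1).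
have p1D : critical D s j p1 by apply: IH sj p1C _; rewrite p1E; rewrite pE ltnS in pn.
have p1N : paths e s j != finset.set0 by apply/set0Pn; exists p1; case/andP: p1C.
have [r [_ ru]] := Dgen _ _ sj p1N.
by rewrite -(ru _ p1D) -(ru _ q1D).
Qed.

(** * Passing from critical paths to maxoids and faces *)

Lemma critical_sub_generic C D : critical_sub C D -> generic e D -> generic e C.
Proof.
move=> CD Dgen i j ij ijN; have [p pC] := critical_exists C ijN.
exists p; split=> // q qC; have [r [_ ru]] := Dgen i j ij ijN.
by rewrite -(ru _ (CD _ _ _ ij pC)) -(ru _ (CD _ _ _ ij qC)).
Qed.

(** The weights enter a maxoid only through the critical DAGs, whose edges depend only on critical
    paths between distinct nodes. *)
Lemma maxoid_eq_critical C D : critical_sub C D -> critical_sub D C ->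
  maxoid e C = maxoid e D.
Proof.
move=> CD DC; have gE L : critical_dag C L =2 critical_dag D L.
  move=> i j; apply: andb_id2l => ij; congr (_ && _); apply: eq_forallb => p.
  by congr (_ ==> _); apply/idP/idP => [/CD|/DC]; exact.
have gE' L : critical_dag C L = critical_dag D L.
  by apply/funext => i; apply/funext => j; exact: gE.
have sE : star_connected C = star_connected D.
  apply/funext => L; apply/funext => i; apply/funext => j.
  by rewrite /star_connected /star_path gE'.
by apply: eq_finset => -[[A B] L]; rewrite /star_separated sE.
Qed.

(* The value is 0 when F is not a face. *)
Definition face_functional (F : set 'rV[R]_#|edge e|) : 'rV[R]_#|edge e| :=
  xget 0 [set c | F = maximizers P c].

Lemma face_functionalP F : face P F -> F = maximizers P (face_functional F).
Proof. by case=> _ [c Fc]; rewrite /face_functional; case: xgetP => [_ _ //|/(_ c)]. Qed.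

Lemma maximizers_face C : face P (maximizers P C).
Proof. by split; [exact: maximizers_neq0|exists C]. Qed.

Lemma vertex_maximizers C (v : 'rV[R]_#|edge e|) : maximizers P C = [set v] -> vertex P v.
Proof. by move=> vE; rewrite /vertex -vE; exact: maximizers_face. Qed.

Lemma vertex_generic (v : 'rV[R]_#|edge e|) :
  vertex P v -> generic e (face_functional [set v]).
Proof. by move=> /face_functionalP vE; apply/maximizers_set1P; exists v; rewrite -vE. Qed.

Lemma dimension_maximizers C : (1 <= dimension (maximizers P C))%N <-> ~ generic e C.
Proof.
split=> [/dimension_gt0P[x [y [xC yC xy]]]/maximizers_set1P[v vE]|Cgen].
  by move: xC yC xy; rewrite vE /= => -> ->; rewrite eqxx.
apply: contrapT => dim; apply: Cgen; apply/maximizers_set1P.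
have [x xC] := maximizers_neq0 C; exists x; apply/seteqP; split=> [y yC|_ -> //].
apply: contrapT => /eqP yx; apply: dim; apply/dimension_gt0P.
by exists y, x.
Qed.

End Maxoids.

Theorem corollary3p2 (R : realType) (V : finType) (e : rel V)
    (dag : acyclic e) :
  let P := maxoid_polytope R e in
  (exists phi : 'rV[R]_#|edge e| -> {set ci_statement V},
     [/\ set_bij [set v | vertex P v] [set M | generic_maxoid R e M] phi,
         forall v, vertex P v -> interior (normal_cone P [set v]) !=set0,
         forall v C, vertex P v -> interior (normal_cone P [set v]) C ->
           generic e C /\ maxoid e C = phi v &
         forall C : 'rV[R]_#|edge e|, generic e C ->
           exists2 v, vertex P v & interior (normal_cone P [set v]) C]) /\
  (exists psi : set 'rV[R]_#|edge e| -> {set ci_statement V},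
     [/\ set_surj [set F | face P F /\ (1 <= dimension F)%N]
           [set M | nongeneric_maxoid R e M] psi,
         forall F, face P F -> (1 <= dimension F)%N ->
           relative_interior (normal_cone P F) !=set0,
         forall F C, face P F -> (1 <= dimension F)%N ->
           relative_interior (normal_cone P F) C ->
           ~ generic e C /\ maxoid e C = psi F &
         forall C : 'rV[R]_#|edge e|, ~ generic e C ->
           exists F, [/\ face P F, (1 <= dimension F)%N &
                         relative_interior (normal_cone P F) C]]).
Proof.
have {dag} maxoid_inj C D := @maxoid_critical R V e C D dag.
move=> P; have maxE C D : critical_sub C D -> critical_sub D C ->
    maximizers P C = maximizers P D.
  by move=> CD DC; apply/seteqP; split; exact/maximizers_subP.
have interior_self C : generic e C -> interior (normal_cone P (maximizers P C)) C.
  by move=> Cgen; apply/(interior_normal_coneP _ Cgen); split=> i j p ij.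
have relint_self C : relative_interior (normal_cone P (maximizers P C)) C.
  by apply/relative_interior_normal_coneP; split=> i j p ij.
split.
  (* The choice of functional is harmless: all functionals with the same face have the same critical
     paths, hence the same maxoid. *)
  exists (fun v => maxoid e (face_functional [set v])); split.
  - split.
    + by move=> v vP; exists (face_functional [set v]) => //; exact: vertex_generic.
    (* Injectivity: equal generic maxoids have the same critical paths, hence come from the same
       face. *)
    + move=> v w /set_mem vP /set_mem wP E.
      suff vw : [set v] = [set w] by have : [set w] v by rewrite -vw.
      rewrite (face_functionalP vP) (face_functionalP wP); apply: maxE.
        exact: maxoid_inj (vertex_generic vP) (vertex_generic wP) E.
      exact: maxoid_inj (vertex_generic wP) (vertex_generic vP) (esym E).
    + move=> _ [C Cgen ->]; have [v vE] := (maximizers_set1P C).2 Cgen.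
      have vP := vertex_maximizers vE; exists v; first exact: vP.
      rewrite /=; have := face_functionalP vP; rewrite -vE => CE.
      by apply: maxoid_eq_critical; apply/maximizers_subP; rewrite -CE.
  - move=> v vP; exists (face_functional [set v]).
    rewrite {1}(face_functionalP vP); exact/interior_self/vertex_generic.
  - move=> v C vP; rewrite {1}(face_functionalP vP).
    move=> /(interior_normal_coneP _ (vertex_generic vP))[vC Cv]; split.
      exact: critical_sub_generic Cv (vertex_generic vP).
    exact: maxoid_eq_critical.
  - move=> C Cgen; have [v vE] := (maximizers_set1P C).2 Cgen.
    exists v; first exact: vertex_maximizers vE.
    by rewrite -vE; exact: interior_self.
(* Only surjectivity is claimed here; [maxoid_inj] concerns generic matrices. *)
exists (fun F => maxoid e (face_functional F)); split.
- move=> _ [C Cgen ->]; exists (maximizers P C).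
    by split; [exact: maximizers_face|exact/dimension_maximizers].
  have CE := face_functionalP (maximizers_face C).
  by apply: maxoid_eq_critical; apply/maximizers_subP; rewrite -CE.
- move=> F FP _; exists (face_functional F).
  by rewrite {1}(face_functionalP FP).
- move=> F C FP; rewrite {1 2}(face_functionalP FP).
  move=> /dimension_maximizers Fgen /relative_interior_normal_coneP[FC CF]; split.
    by move/(critical_sub_generic FC).
  exact: maxoid_eq_critical.
- move=> C Cgen; exists (maximizers P C); split=> //.
    exact: maximizers_face.
  exact/dimension_maximizers.
Qed.
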